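(* Let $H$ be any bialgebra over a field $k$. For all natural numbers $n,m$ and all permutations $\sigma\in\mathfrak S_n$, $\tau\in\mathfrak S_m$, one has $$\Psi^{(n,\sigma)}\circ\Psi^{(m,\tau)}=\Psi^{(nm,\Phi(\sigma,\tau))}$$ as linear maps $H\to H$.
   Context: A bialgebra is associative with unit and coassociative with counit, with multiplication $\mu:H\otimes H\to H$ and comultiplication $\Delta:H\to H\otimes H$; no commutativity or cocommutativity is assumed. $\mathfrak S_n$ is the group of permutations on $n$ letters $\{1,\dots,n\}$. For a natural number $n$, $\Delta^n:H\to H^{\otimes n}$ is the $(n-1)$-th iteration of the comultiplication $\Delta$, and $\mu^n:H^{\otimes n}\to H$ is the $(n-1)$-th iteration of the multiplication $\mu$. For $\sigma\in\mathfrak S_n$, the map $\sigma_*:H^{\otimes n}\to H^{\otimes n}$ is induced by the permutation $\sigma$, that is, $$\sigma_*(x_1\otimes\cdots\otimes x_n)=x_{\sigma 1}\otimes\cdots\otimes x_{\sigma n}.$$ The map $\Psi^{(n,\sigma)}:H\to H$ is the composition $\Psi^{(n,\sigma)}=\mu^n\circ\sigma_*\circ\Delta^n$. The map $\Phi:\mathfrak S_n\times\mathfrak S_m\to\mathfrak S_{nm}$ is defined by $$\Phi(\sigma,\tau)(x)=\tau(p+1)+m(\sigma(q)-1),\qquad 1\le x\le nm,$$ where $x=pn+q$ with $1\le q\le n$ and $0\le p\le m-1$.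
   Formalization: The map σ_* is taken to send the i-th tensor factor to position σ(i), instead of putting x_{σi} in position i as displayed; with the displayed formula the identity fails (e.g. n=m=2, σ=id, τ=(1 2)). Also n or m = 0 is allowed. *)

(* Defs.v *)
From HB Require Import structures.
From mathcomp Require Import all_boot all_order all_algebra all_fingroup.
From mathcomp Require Import boolp generic_quotient freeg.

Set Implicit Arguments.
Unset Strict Implicit.
Unset Printing Implicit Defensive.

Import GRing.Theory.
Local Open Scope ring_scope.
Local Open Scope quotient_scope.

(* Tensor powers of a vector space of arbitrary dimension: the free vector
   space on V^n modulo the span of the multilinearity relators. *)

Inductive lspan (k : fieldType) (M : lmodType k) (R : M -> Prop) : M -> Prop :=
| lspan_gen x : R x -> lspan R x
| lspan_0 : lspan R 0
| lspan_lin a x y : lspan R x -> lspan R y -> lspan R (a *: x + y).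

Section TensorPower.
Variables (k : fieldType) (V : lmodType k) (n : nat).
Implicit Types (x : {ffun 'I_n -> V}) (i : 'I_n) (a : k) (u v : V).

Definition slot x i u : {ffun 'I_n -> V} :=
  [ffun j => if j == i then u else x j].

Definition multilinear (W : lmodType k) (f : {ffun 'I_n -> V} -> W) :=
  forall x i a u v,
    f (slot x i (a *: u + v)) = a *: f (slot x i u) + f (slot x i v).

Definition mrelator (t : {freeg {ffun 'I_n -> V} / k}) : Prop :=
  exists x i a u v,
    t = << slot x i (a *: u + v) >>
        - (a *: << slot x i u >> + << slot x i v >>).

Definition mrelators : {pred {freeg {ffun 'I_n -> V} / k}} :=
  fun t => `[< lspan mrelator t >].

Lemma mrelators_submod_closed : submod_closed mrelators.
Proof.
split=> [|a x y]; first by apply/asboolP/lspan_0.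
by move=> /asboolP Rx /asboolP Ry; apply/asboolP/lspan_lin.
Qed.

HB.instance Definition _ :=
  GRing.isSubmodClosed.Build _ _ mrelators mrelators_submod_closed.

Definition tens : Type := Quotient.quot mrelators.

HB.instance Definition _ := Choice.on tens.
HB.instance Definition _ := GRing.Zmodule.on tens.
HB.instance Definition _ := EqQuotient.on tens.

Let pi (D : {freeg {ffun 'I_n -> V} / k}) : tens := \pi_(Quotient.quot mrelators) D.

Let pi_eq D E : (pi D = pi E) <-> (D - E \in mrelators).
Proof. by rewrite Quotient.idealrBE; split=> /eqP. Qed.

Let piD D E : pi (D + E) = pi D + pi E.
Proof. by rewrite /pi !piE. Qed.

Let reprP D : repr (pi D) - D \in mrelators.
Proof. by apply/pi_eq; rewrite /pi reprK. Qed.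

Definition tens_scale a (t : tens) : tens := pi (a *: repr t).

Let piZ a D : pi (a *: D) = tens_scale a (pi D).
Proof. by apply/esym/pi_eq; rewrite -scalerBr rpredZ. Qed.

Let piP (t : tens) : {D | t = pi D}.
Proof. by exists (repr t); rewrite /pi reprK. Qed.

Lemma tens_scaleA a b t : tens_scale a (tens_scale b t) = tens_scale (a * b) t.
Proof. by have [D ->] := piP t; rewrite -!piZ scalerA. Qed.

Lemma tens_scale1 t : tens_scale 1 t = t.
Proof. by have [D ->] := piP t; rewrite -!piZ scale1r. Qed.

Lemma tens_scaleDr a t1 t2 :
  tens_scale a (t1 + t2) = tens_scale a t1 + tens_scale a t2.
Proof.
by have [D ->] := piP t1; have [E ->] := piP t2; rewrite -piD -!piZ scalerDr piD.
Qed.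

Lemma tens_scaleDl t a b :
  tens_scale (a + b) t = tens_scale a t + tens_scale b t.
Proof. by have [D ->] := piP t; rewrite -!piZ scalerDl piD. Qed.

HB.instance Definition _ := GRing.Zmodule_isLmodule.Build k tens
  tens_scaleA tens_scale1 tens_scaleDr tens_scaleDl.

Definition tpure x : tens := pi << x >>.

(* The linear map induced on the tensor power by a multilinear map f; see
   tlift_linear and tlift_tpure. The value is meaningless for other f. *)
Definition tlift (W : lmodType k) (f : {ffun 'I_n -> V} -> W) (t : tens) : W :=
  fglift f (repr t).

Lemma tpure_multilinear : multilinear tpure.
Proof.
move=> x i a u v; rewrite /tpure -[a *: pi _]piZ -piD; apply/pi_eq.
by apply/asboolP/lspan_gen; exists x, i, a, u, v.
Qed.

Section Lift.
Variables (W : lmodType k) (f : {ffun 'I_n -> V} -> W).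

Lemma fglift_linear : linear (fglift f : {freeg {ffun 'I_n -> V} / k} -> W).
Proof.
have liftB D E : fglift f (D - E) = fglift f D - fglift f E.
  exact: lift_is_additive.
have lift0 : fglift f 0 = 0 by rewrite -[X in fglift f X](subrr 0) liftB subrr.
have liftD D E : fglift f (D + E) = fglift f D + fglift f E.
  by rewrite -{1}[E]opprK liftB -[- E]sub0r liftB lift0 sub0r opprK.
have lift_sum (r : seq {ffun 'I_n -> V}) c :
    fglift f (\sum_(x <- r) << c x *g x >>) = \sum_(x <- r) c x *: f x.
  elim: r => [|x r IHr]; first by rewrite !big_nil.
  by rewrite !big_cons liftD liftU IHr.
move=> a D E; rewrite liftD; congr (_ + _).
rewrite [a *: D]/(fgscale a D) /fgscale lift_sum.
rewrite -{3}[D]freeg_sumE lift_sum scaler_sumr.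
by apply: eq_bigr => x _; rewrite scalerA.
Qed.

Hypothesis f_lin : multilinear f.

Let tlift_pi D : tlift f (pi D) = fglift f D.
Proof.
pose g := HB.pack_for {linear {freeg {ffun 'I_n -> V} / k} -> W} (fglift f)
  (GRing.isLinear.Build _ _ _ _ _ fglift_linear).
apply/eqP; rewrite -subr_eq0 -[_ - _](linearB g); apply/eqP.
have /asboolP := reprP D.
elim=> [_ [x [i [a [u [v ->]]]]]||a E F _ gE _ gF].
- by rewrite linearB linearP /= !liftU !scale1r f_lin subrr.
- exact: linear0.
- by rewrite linearP gE gF scaler0 addr0.
Qed.

Lemma tlift_tpure x : tlift f (tpure x) = f x.
Proof. by rewrite tlift_pi liftU scale1r. Qed.

Lemma tlift_linear : linear (tlift f).
Proof.
move=> a s t; have [D ->] := piP s; have [E ->] := piP t.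
by rewrite -[a *: pi _]piZ -piD !tlift_pi fglift_linear.
Qed.

End Lift.

Lemma tens_ind (P : tens -> Prop) :
  P 0 -> (forall a x t, P t -> P (a *: tpure x + t)) -> forall t, P t.
Proof.
move=> P0 PD t; have [D ->] := piP t.
have pi0 : pi 0 = 0 by apply: (addrI (pi 0)); rewrite -piD !addr0.
rewrite -[D]freeg_sumE; elim: (dom D) => [|x r IHr]; first by rewrite big_nil pi0.
rewrite big_cons piD; set c := coeff x D.
have -> : << c *g x >> = c *: << x >> :> {freeg {ffun 'I_n -> V} / k}.
  by apply/eqP/freeg_eqP => y; rewrite coeffZ !coeffU mul1r.
by rewrite piZ; apply: PD.
Qed.

End TensorPower.

Section TensorOps.
Variables (k : fieldType) (V : lmodType k).

(* The identification V = V^{(x)1}. *)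
Definition tsingle (u : V) : tens V 1 := tpure [ffun=> u].

Definition fcat a b (x : {ffun 'I_a -> V}) (y : {ffun 'I_b -> V}) :
    {ffun 'I_(a + b) -> V} :=
  [ffun i => match split i with inl j => x j | inr j => y j end].

(* s (x) t, identifying V^{(x)a} (x) V^{(x)b} with V^{(x)(a + b)}. *)
Definition tcat a b (s : tens V a) (t : tens V b) : tens V (a + b) :=
  tlift (fun x => tlift (fun y => tpure (fcat x y)) t) s.

Definition tmap2 a b (f : V -> tens V a) (g : V -> tens V b) (t : tens V 2) :
    tens V (a + b) :=
  tlift (fun x : {ffun 'I_2 -> V} => tcat (f (x ord0)) (g (x ord_max))) t.

(* sigma_* sends the i-th factor to position sigma i; this is the covariant
   action, (sigma o tau)_* = sigma_* o tau_*. The formula sigma_*(x_1 (x) ...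
   (x) x_n) = x_{sigma 1} (x) ... (x) x_{sigma n}, read literally as putting
   the factor x_{sigma i} in position i, would give the inverse (contravariant)
   action, for which Psi (Phi s t), with Phi as below, is Psi t \o Psi s and in
   general differs from Psi s \o Psi t. *)
Definition tens_perm n (s : 'S_n) (t : tens V n) : tens V n :=
  tlift (fun x => tpure [ffun i => x ((s^-1)%g i)]) t.

End TensorOps.

Section Linearity.
Variable k : fieldType.

Lemma lin0 (U W : lmodType k) (f : U -> W) : linear f -> f 0 = 0.
Proof. by move=> f_lin; rewrite -[X in f X](addNr 0) -scaleN1r f_lin scaleN1r addNr. Qed.

Lemma tlift_multilinear (V V' W : lmodType k) n n'
    (f : {ffun 'I_n -> V} -> {ffun 'I_n' -> V'} -> W) t :
    (forall y, multilinear (f^~ y)) -> (forall x, multilinear (f x)) ->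
  multilinear (fun x => tlift (f x) t).
Proof.
move=> fl fr x i a u v; have lin z := tlift_linear (fr z).
elim/tens_ind: t => [|d y t IHt]; first by rewrite !(lin0 (lin _)) scaler0 addr0.
by rewrite !lin !tlift_tpure // IHt fl !scalerDr !scalerA mulrC addrACA.
Qed.

Variable V : lmodType k.

Let fcat_multilinearr a b (x : {ffun 'I_a -> V}) :
  multilinear (fun y : {ffun 'I_b -> V} => tpure (fcat x y)).
Proof.
move=> y i c u v; have E w : fcat x (slot y i w) = slot (fcat x y) (rshift a i) w.
  apply/ffunP => j; rewrite !ffunE; case: (split_ordP j) => j' ->.
    by rewrite eq_lrshift.
  by rewrite ffunE eq_rshift.
by rewrite !E tpure_multilinear.
Qed.

Let fcat_multilinearl a b (y : {ffun 'I_b -> V}) :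
  multilinear (fun x : {ffun 'I_a -> V} => tpure (fcat x y)).
Proof.
move=> x i c u v; have E w : fcat (slot x i w) y = slot (fcat x y) (lshift b i) w.
  apply/ffunP => j; rewrite !ffunE; case: (split_ordP j) => j' ->.
    by rewrite ffunE eq_lshift.
  by rewrite eq_rlshift.
by rewrite !E tpure_multilinear.
Qed.

Lemma tcat_linearl a b (t : tens V b) : linear (fun s : tens V a => tcat s t).
Proof. by apply: tlift_linear; apply: tlift_multilinear. Qed.

Lemma tcat_linearr a b (s : tens V a) : linear (fun t : tens V b => tcat s t).
Proof.
move=> c t1 t2; rewrite /tcat.
have tl t : multilinear (fun x => tlift (fun y => tpure (fcat x y)) t : tens V (a + b)).
  by apply: tlift_multilinear.
elim/tens_ind: s => [|d x s IHs].
  by rewrite !(lin0 (tlift_linear (tl _))) scaler0 addr0.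
rewrite !(tlift_linear (tl _)) !(tlift_tpure (tl _)) IHs.
rewrite (tlift_linear (fcat_multilinearr _)).
by rewrite !scalerDr !scalerA mulrC addrACA.
Qed.

Lemma tsingle_linear : linear (@tsingle k V).
Proof.
move=> a u v; have E w : tsingle w = tpure (slot [ffun=> 0 : V] (ord0 : 'I_1) w).
  by congr tpure; apply/ffunP=> i; rewrite !ffunE ord1.
by rewrite !E tpure_multilinear.
Qed.

Lemma tens_perm_multilinear n (s : 'S_n) :
  multilinear (fun x : {ffun 'I_n -> V} => tpure [ffun i => x ((s^-1)%g i)]).
Proof.
move=> x i a u v.
have E w : [ffun j => slot x i w ((s^-1)%g j)]
           = slot [ffun j => x ((s^-1)%g j)] (s i) w.
  by apply/ffunP => j; rewrite !ffunE (canF_eq (permKV s)).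
by rewrite !E tpure_multilinear.
Qed.

End Linearity.

Definition tmul2 (k : fieldType) (A : algType k) (s t : tens A 2) : tens A 2 :=
  tlift (fun x => tlift (fun y => tpure [ffun i => x i * y i]) t) s.

HB.mixin Record Algebra_isBialgebra (k : fieldType) H of GRing.Algebra k H := {
  comul : H -> tens H 2;
  counit : H -> k;
  comul_linear : linear comul;
  counit_linear : scalar counit;
  comulA : forall h : H,
    tmap2 comul (@tsingle k H) (comul h) = tmap2 (@tsingle k H) comul (comul h)
      :> tens H 3;
  counit_comull : forall h : H,
    tlift (fun x : {ffun 'I_2 -> H} => counit (x ord0) *: x ord_max) (comul h)
      = h;
  counit_comulr : forall h : H,
    tlift (fun x : {ffun 'I_2 -> H} => counit (x ord_max) *: x ord0) (comul h)
      = h;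
  comulM : forall g h : H, comul (g * h) = tmul2 (comul g) (comul h);
  comul1 : comul 1 = tpure [ffun=> 1];
  counitM : forall g h : H, counit (g * h) = counit g * counit h;
  counit1 : counit 1 = 1
}.

#[short(type="bialgType")]
HB.structure Definition Bialgebra (k : fieldType) :=
  {H of Algebra_isBialgebra k H & GRing.Algebra k H}.

Section Psi.
Variables (k : fieldType) (H : bialgType k).

(* Delta (x) id^{(x)n} *)
Definition comul_head n (t : tens H n.+1) : tens H n.+2 :=
  tlift (fun x : {ffun 'I_(1 + n) -> H} =>
    tcat (comul (x ord0)) (tpure [ffun j => x (rshift 1 j)])) t.

(* mu (x) id^{(x)n} *)
Definition mul_head n (t : tens H n.+2) : tens H n.+1 :=
  tlift (fun x : {ffun 'I_(2 + n) -> H} =>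
    tcat (tsingle (x (lshift n ord0) * x (lshift n ord_max)))
         (tpure [ffun j => x (rshift 2 j)])) t.

Lemma comul_head_multilinear n : multilinear (fun x : {ffun 'I_(1 + n) -> H} =>
    tcat (comul (x ord0)) (tpure [ffun j => x (rshift 1 j)])).
Proof.
move=> x i a u v; have [i0 -> | j ->] := split_ordP i.
  rewrite ord1 !ffunE /=.
  have E w : [ffun j => slot x (lshift n ord0) w (rshift 1 j)] = [ffun j => x (rshift 1 j)].
    by apply/ffunP=> j; rewrite !ffunE eq_rlshift.
  rewrite !E.
  by rewrite comul_linear (tcat_linearl _ a).
have E w : [ffun i => slot x (rshift 1 j) w (rshift 1 i)] = slot [ffun i => x (rshift 1 i)] j w.
  by apply/ffunP=> l; rewrite !ffunE eq_rshift.
by rewrite !E tpure_multilinear !ffunE /= tcat_linearr.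
Qed.

Lemma mul_head_multilinear n : multilinear (fun x : {ffun 'I_(2 + n) -> H} =>
    tcat (tsingle (x (lshift n ord0) * x (lshift n ord_max)))
         (tpure [ffun j => x (rshift 2 j)])).
Proof.
move=> x i a u v; have [i' -> | j ->] := split_ordP i.
  have E w : [ffun j => slot x (lshift n i') w (rshift 2 j)] = [ffun j => x (rshift 2 j)].
    by apply/ffunP=> j; rewrite !ffunE eq_rlshift.
  rewrite !E !ffunE !eq_lshift -(tcat_linearl _ a) -tsingle_linear; congr (tcat (tsingle _) _).
  case: (unliftP ord0 i') => [i2|] -> /=; last by rewrite mulrDl scalerAl.
  by rewrite [i2]ord1 /= mulrDr scalerAr.
have E w : [ffun i => slot x (rshift 2 j) w (rshift 2 i)] = slot [ffun i => x (rshift 2 i)] j w.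
  by apply/ffunP=> l; rewrite !ffunE eq_rshift.
by rewrite !E tpure_multilinear !ffunE !eq_lrshift tcat_linearr.
Qed.

Fixpoint comul_iterS p : H -> tens H p.+1 :=
  match p with
  | 0 => @tsingle k H
  | q.+1 => fun h => comul_head (comul_iterS q h)
  end.

Fixpoint mul_iterS p : tens H p.+1 -> H :=
  match p with
  | 0 => tlift (fun x => x ord0)
  | q.+1 => fun t => mul_iterS (mul_head t)
  end.

(* Delta^n and mu^n are the (n-1)-fold iterations; for n = 0, by the usual
   convention, they are the counit H -> k = H^{(x)0} and the unit k -> H. *)
Definition comul_iter n : H -> tens H n :=
  match n with
  | 0 => fun h => counit h *: tpure [ffun=> 0]
  | p.+1 => @comul_iterS p
  end.

Definition mul_iter n : tens H n -> H :=
  match n with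
  | 0 => tlift (fun=> 1)
  | p.+1 => @mul_iterS p
  end.

Definition Psi n (s : 'S_n) (h : H) : H := mul_iter (tens_perm s (comul_iter n h)).

Lemma comul_iter_linear n : linear (@comul_iter n).
Proof.
case: n => [|p] a u v; first by rewrite /= counit_linear scalerDl scalerA.
rewrite /comul_iter; elim: p => [|p IHp] /=; first exact: tsingle_linear.
by rewrite IHp /comul_head (tlift_linear (@comul_head_multilinear p)).
Qed.

Lemma mul_iter_linear n : linear (@mul_iter n).
Proof.
case: n => [|p]; first by apply: tlift_linear => x [].
rewrite /mul_iter; elim: p => [|p IHp] /=.
  by apply: tlift_linear => x i a u v; rewrite !ffunE [i]ord1.
by move=> a u v; rewrite /mul_head (tlift_linear (@mul_head_multilinear p)) IHp.
Qed.

Lemma Psi_linear n (s : 'S_n) : linear (@Psi n s).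
Proof.
move=> a u v; rewrite /Psi comul_iter_linear /tens_perm.
by rewrite (tlift_linear (tens_perm_multilinear s)) mul_iter_linear.
Qed.
HB.instance Definition _ n (s : 'S_n) := GRing.isLinear.Build k H H _ (@Psi n s) (Psi_linear s).

End Psi.

(* Letters are numbered from 0: for 0 <= q < n and 0 <= p < m, Phi s t sends
   p * n + q to t p + m * s q. *)
Section Phi.
Variables (n m : nat) (s : 'S_n) (t : 'S_m).

Lemma Phi_quo_subproof (x : 'I_(n * m)) : (x %/ n < m)%N.
Proof. by rewrite ltn_divLR ?[(m * n)%N]mulnC //; case: n x => // -[]. Qed.

Lemma Phi_rem_subproof (x : 'I_(n * m)) : (x %% n < n)%N.
Proof. by rewrite ltn_mod; case: n x => // -[]. Qed.

Definition Phi_quo x : 'I_m := Ordinal (Phi_quo_subproof x).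
Definition Phi_rem x : 'I_n := Ordinal (Phi_rem_subproof x).

Lemma Phi_subproof (x : 'I_(n * m)) :
  (t (Phi_quo x) + m * s (Phi_rem x) < n * m)%N.
Proof.
have := ltn_ord (s (Phi_rem x)); have := ltn_ord (t (Phi_quo x)) => lt_t lt_s.
apply: (@leq_trans (m + m * s (Phi_rem x))%N); first by rewrite ltn_add2r.
by rewrite -mulnS mulnC leq_mul2r lt_s orbT.
Qed.

Definition Phi_fun (x : 'I_(n * m)) : 'I_(n * m) := Ordinal (Phi_subproof x).

Lemma Phi_fun_inj : injective Phi_fun.
Proof.
move=> x y /(congr1 val) /= eq_xy.
have m_gt0 : (0 < m)%N by exact: leq_ltn_trans (ltn_ord (Phi_quo x)).
have eq_q : Phi_quo x = Phi_quo y.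
  apply: (@perm_inj _ t); apply: val_inj; move/(congr1 (modn^~ m)): eq_xy.
  by rewrite /= ![(t _ + _)%N]addnC ![(m * _)%N]mulnC !modnMDl !modn_small.
have eq_r : Phi_rem x = Phi_rem y.
  apply: (@perm_inj _ s); apply: val_inj; apply/eqP.
  by rewrite -(eqn_pmul2l m_gt0) -(eqn_add2l (t (Phi_quo x))) {2}eq_q eq_xy.
apply: val_inj; rewrite /= (divn_eq x n) (divn_eq y n).
by congr (_ * _ + _)%N; [move/(congr1 val): eq_q | move/(congr1 val): eq_r].
Qed.

Definition Phi : 'S_(n * m) := perm Phi_fun_inj.

End Phi.

(* Main.v *)
Require Import Defs.
From mathcomp Require Import all_boot all_order all_algebra all_fingroup.
From mathcomp Require Import boolp.

Set Implicit Arguments.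
Unset Strict Implicit.
Unset Printing Implicit Defensive.

Import GRing.Theory.
Local Open Scope ring_scope.

(** In Sweedler notation, Psi t h is the product over j of the factors
    h_(t^-1 j) of Delta^m h. Iterated coproducts are multiplicative, so the
    i-th factor of Delta^n (Psi t h) is the product over j of the i-th factors
    of Delta^n h_(t^-1 j), and hence
      Psi s (Psi t h)
        = \prod_(i < n) \prod_(j < m) (s^-1 i)-th factor of Delta^n h_(t^-1 j).
    By coassociativity, applying Delta^n to every factor of Delta^m h gives
    Delta^(m n) h, the q-th factor of Delta^n h_p being the factor of index
    p n + q. So the double product is the product of all the factors of
    Delta^(n m) h, in an order where the one of index (t^-1 j) n + s^-1 i comes
    at position i m + j. This is Psi (Phi s t) h, because Phi s t sends
    (t^-1 j) n + s^-1 i to i m + j (Phi_inv_val).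

    The two structural inputs are comul_iter_prod (Delta^n is multiplicative,
    for the factorwise product tmul on tensors) and comul_iter_flat
    (Delta^(m n) is Delta^m followed by Delta^n on each factor). The latter
    rests on the generalized coassociativity comul_iterD, that is,
    (Delta^a (x) Delta^b) o Delta = Delta^(a + b). As the tensors Delta^n h_p
    are not pure in general, the final comparison views both sides as
    multilinear in these m tensors, and multilinear_tpure_ext then lets them be
    replaced by pure ones. *)

(** * Linear and multilinear maps on tensor powers *)

Lemma slot_id (k : fieldType) (V : lmodType k) n (x : {ffun 'I_n -> V}) i :
  slot x i (x i) = x.
Proof. by apply/ffunP => j; rewrite ffunE; case: eqP => // ->. Qed.

Lemma linZ (k : fieldType) (U W : lmodType k) (f : U -> W) c u :
  linear f -> f (c *: u) = c *: f u.
Proof. by move=> fl; have := fl c u 0; rewrite (lin0 fl) !addr0. Qed.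

Section Tensors.
Variables (k : fieldType) (V : lmodType k).

Lemma eq_multilinear n (W : lmodType k) (f g : {ffun 'I_n -> V} -> W) :
  f =1 g -> multilinear f -> multilinear g.
Proof. by move=> fg fl x i a u v; rewrite -!fg fl. Qed.

Lemma eq_tlift n (W : lmodType k) (f g : {ffun 'I_n -> V} -> W) (t : tens V n) :
  f =1 g -> tlift f t = tlift g t.
Proof. by move=> /funext ->. Qed.

Lemma linear_multilinear n (U W : lmodType k) (L : U -> W)
    (f : {ffun 'I_n -> V} -> U) :
  linear L -> multilinear f -> multilinear (fun x => L (f x)).
Proof. by move=> Ll fl x i a u v; rewrite fl Ll. Qed.

Lemma multilinear_reindex n n' (W : lmodType k)
    (c : 'I_n -> 'I_n') (d : 'I_n' -> 'I_n) (f : {ffun 'I_n -> V} -> W) :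
    cancel c d -> cancel d c -> multilinear f ->
  multilinear (fun z : {ffun 'I_n' -> V} => f [ffun i => z (c i)]).
Proof.
move=> cK dK fl z i a u v.
have E w : [ffun j => slot z i w (c j)] = slot [ffun j => z (c j)] (d i) w.
  by apply/ffunP => j; rewrite !ffunE (can2_eq cK dK).
by rewrite !E fl.
Qed.

Lemma tens_linear_ext n (W : lmodType k) (f g : tens V n -> W) :
    linear f -> linear g -> (forall x, f (tpure x) = g (tpure x)) ->
  f =1 g.
Proof.
move=> fl gl fg; elim/tens_ind => [|a x t IHt]; first by rewrite !lin0.
by rewrite fl gl fg IHt.
Qed.

Lemma linear_tlift n (U W : lmodType k) (L : U -> W)
    (f : {ffun 'I_n -> V} -> U) (t : tens V n) :
    linear L -> multilinear f ->
  L (tlift f t) = tlift (fun x => L (f x)) t.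
Proof.
move=> Ll fl; have Lfl := linear_multilinear Ll fl.
apply: (tens_linear_ext (f := fun t => L (tlift f t))) t => [a s t||x].
- by rewrite (tlift_linear fl) Ll.
- exact: tlift_linear.
- by rewrite !tlift_tpure.
Qed.

(** The form in which a computation with pure tensors is transported to
    arbitrary ones: the components are replaced by combinations of pure tensors
    one at a time, the components of index at least c being already pure at
    stage c of the induction. *)
Lemma multilinear_tpure_ext n m (W : lmodType k)
    (F G : {ffun 'I_m -> tens V n} -> W) :
    multilinear F -> multilinear G ->
    (forall u : 'I_m -> {ffun 'I_n -> V},
       F [ffun p => tpure (u p)] = G [ffun p => tpure (u p)]) ->
  F =1 G.
Proof.
move=> Fl Gl FG y.
pose pure_from c (z : {ffun 'I_m -> tens V n}) :=
  forall p : 'I_m, (c <= p)%N -> exists x, z p = tpure x.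
suff: forall c z, pure_from c z -> F z = G z.
  by move=> /(_ m y); apply=> p; rewrite leqNgt ltn_ord.
elim=> [|c IHc] z zP.
  have [u uP] := fin_all_exists (fun p => zP p isT).
  have -> : z = [ffun p => tpure (u p)] by apply/ffunP => p; rewrite ffunE.
  exact: FG.
have [le_mc|lt_cm] := leqP m c.
  by apply: IHc => p le_cp; have := leq_trans le_mc le_cp; rewrite leqNgt ltn_ord.
pose i := Ordinal lt_cm; rewrite -(slot_id z i).
have slotl (E : {ffun 'I_m -> tens V n} -> W) :
    multilinear E -> linear (fun w => E (slot z i w)).
  by move=> El a u v; rewrite El.
apply: (tens_linear_ext (slotl _ Fl) (slotl _ Gl)) => x.
apply: IHc => p; rewrite leq_eqVlt ffunE => /orP [/eqP cp|lt_cp].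
  by exists x; case: eqP => // -[]; apply: val_inj; rewrite /= cp.
by case: eqP => [_|_]; [exists x | apply: zP].
Qed.

(** * Concatenation of families and of tensors *)

Lemma fcatl a b (x : {ffun 'I_a -> V}) (y : {ffun 'I_b -> V}) i :
  fcat x y (lshift b i) = x i.
Proof. by rewrite ffunE -[lshift b i]/(unsplit (inl i)) unsplitK. Qed.

Lemma fcatr a b (x : {ffun 'I_a -> V}) (y : {ffun 'I_b -> V}) j :
  fcat x y (rshift a j) = y j.
Proof. by rewrite ffunE -[rshift a j]/(unsplit (inr j)) unsplitK. Qed.

(** The variants with _val compare positions as natural numbers: sums such as
    2 + (p + b) and (2 + p) + b are convertible, but the shifts into the
    corresponding ordinals are different terms. *)
Lemma fcatl_val a b (x : {ffun 'I_a -> V}) (y : {ffun 'I_b -> V})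
    (i : 'I_(a + b)) (j : 'I_a) :
  val i = val j -> fcat x y i = x j.
Proof. by move=> ij; rewrite -(fcatl x y); congr (fcat x y _); apply: val_inj. Qed.

Lemma fcatr_val a b (x : {ffun 'I_a -> V}) (y : {ffun 'I_b -> V})
    (i : 'I_(a + b)) (j : 'I_b) :
  val i = (a + val j)%N -> fcat x y i = y j.
Proof. by move=> ij; rewrite -(fcatr x y); congr (fcat x y _); apply: val_inj. Qed.

Lemma fcat_slotl a b (x : {ffun 'I_a -> V}) (y : {ffun 'I_b -> V}) i w :
  fcat (slot x i w) y = slot (fcat x y) (lshift b i) w.
Proof.
apply/ffunP => j; case: (split_ordP j) => j' ->.
  by rewrite fcatl !ffunE eq_lshift -[lshift b j']/(unsplit (inl j')) unsplitK.
by rewrite fcatr !ffunE eq_rlshift -[rshift a j']/(unsplit (inr j')) unsplitK.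
Qed.

Lemma fcat_slotr a b (x : {ffun 'I_a -> V}) (y : {ffun 'I_b -> V}) i w :
  fcat x (slot y i w) = slot (fcat x y) (rshift a i) w.
Proof.
apply/ffunP => j; case: (split_ordP j) => j' ->.
  by rewrite fcatl !ffunE eq_lrshift -[lshift b j']/(unsplit (inl j')) unsplitK.
by rewrite fcatr !ffunE eq_rshift -[rshift a j']/(unsplit (inr j')) unsplitK.
Qed.

Lemma tcat_tpure a b (x : {ffun 'I_a -> V}) (y : {ffun 'I_b -> V}) :
  tcat (tpure x) (tpure y) = tpure (fcat x y).
Proof.
have fr (z : {ffun 'I_a -> V}) :
    multilinear (fun y : {ffun 'I_b -> V} => tpure (fcat z y)).
  by move=> z' i c u v; rewrite !fcat_slotr tpure_multilinear.
rewrite /tcat tlift_tpure ?tlift_tpure //; apply: tlift_multilinear => // z.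
by move=> z' i c u v; rewrite !fcat_slotl tpure_multilinear.
Qed.

Lemma bilinear_multilinear (W : lmodType k) (f : V -> V -> W) :
    (forall v, linear (f^~ v)) -> (forall u, linear (f u)) ->
  multilinear (fun x : {ffun 'I_2 -> V} => f (x ord0) (x ord_max)).
Proof.
move=> fl fr x i c u v; rewrite !ffunE.
case: (unliftP ord0 i) => [j|] -> /=; last exact: fl.
by rewrite ord1 /=; apply: fr.
Qed.

Lemma tmap2_multilinear a b (f : V -> tens V a) (g : V -> tens V b) :
    linear f -> linear g ->
  multilinear (fun x : {ffun 'I_2 -> V} => tcat (f (x ord0)) (g (x ord_max))).
Proof.
move=> fl gl.
apply: (bilinear_multilinear (f := fun u v => tcat (f u) (g v))) => w c u v.
  by rewrite fl tcat_linearl.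
by rewrite gl tcat_linearr.
Qed.

Lemma tmap2_linear a b (f : V -> tens V a) (g : V -> tens V b) :
  linear f -> linear g -> linear (tmap2 f g).
Proof. by move=> fl gl; apply/tlift_linear/tmap2_multilinear. Qed.

Lemma tmap2_tpure a b (f : V -> tens V a) (g : V -> tens V b)
    (x : {ffun 'I_2 -> V}) :
    linear f -> linear g ->
  tmap2 f g (tpure x) = tcat (f (x ord0)) (g (x ord_max)).
Proof. by move=> fl gl; rewrite /tmap2 tlift_tpure //; apply: tmap2_multilinear. Qed.

Lemma tcat0l b (t : tens V b) : tcat (tpure [ffun=> 0]) t = t :> tens V (0 + b).
Proof.
move: t; apply: (tens_linear_ext (W := tens V b) (g := id)) => [||x].
- exact: (@tcat_linearr _ V 0).
- by [].
rewrite tcat_tpure; congr tpure; apply/ffunP => i.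
case: (split_ordP (i : 'I_(0 + b))) => [[]//|j ->].
by rewrite [LHS](fcatr [ffun=> 0] x j); congr (x _); apply: val_inj.
Qed.

Lemma fcatA_val a b c (x : {ffun 'I_a -> V}) (y : {ffun 'I_b -> V})
    (z : {ffun 'I_c -> V}) (i : 'I_(a + (b + c))) (j : 'I_(a + b + c)) :
  val i = val j -> fcat x (fcat y z) i = fcat (fcat x y) z j.
Proof.
case: (split_ordP i) => [i1|i'] -> /=.
  move=> ij; rewrite fcatl (fcatl_val _ _ (j := lshift b i1)) ?fcatl //.
case: (split_ordP i') => [i2|i3] -> /= ij; rewrite !fcatr.
  by rewrite fcatl (fcatl_val _ _ (j := rshift a i2)) ?fcatr.
by rewrite (fcatr_val _ _ (j := i3)) //= -ij addnA.
Qed.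

(** Associativity of tcat, for the left components whose length is a numeral:
    both sides then have convertible types and no transport is needed. *)
Lemma tcatA2 p b (s : tens V 2) (x : {ffun 'I_p -> V}) (y : {ffun 'I_b -> V}) :
  tcat s (tpure (fcat x y)) = tcat (tcat s (tpure x)) (tpure y)
    :> tens V (p + b).+2.
Proof.
move: s; apply: (tens_linear_ext (W := tens V (p + b).+2)) => [||z].
- exact: (@tcat_linearl _ V 2).
- by move=> c u v; rewrite tcat_linearl (@tcat_linearl _ V (2 + p)).
rewrite !tcat_tpure; congr tpure; apply/ffunP => i.
exact: (@fcatA_val 2 p b).
Qed.

Lemma tcatA11 b (u v : V) (t : tens V b) :
  tcat (tcat (tsingle u) (tsingle v)) t = tcat (tsingle u) (tcat (tsingle v) t)
    :> tens V b.+2.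
Proof.
move: t; apply: (tens_linear_ext (W := tens V b.+2)) => [||z].
- exact: (@tcat_linearr _ V 2).
- by move=> c w w'; rewrite tcat_linearr (@tcat_linearr _ V 1 (1 + b)).
rewrite !tcat_tpure; congr tpure; apply/ffunP => i.
exact/esym/(@fcatA_val 1 1 b).
Qed.

Lemma tmap2_single t : tmap2 (@tsingle k V) (@tsingle k V) t = t.
Proof.
have sl := @tsingle_linear k V.
move: t; apply: tens_linear_ext => [||x].
- exact: tmap2_linear.
- by [].
rewrite tmap2_tpure // tcat_tpure; congr tpure; apply/ffunP => i.
case: (split_ordP (i : 'I_(1 + 1))) => j ->.
  by rewrite fcatl ffunE; congr (x _); apply: val_inj; rewrite /= ord1.
by rewrite fcatr ffunE; congr (x _); apply: val_inj; rewrite /= ord1.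
Qed.

(** The canonical map from the m-th tensor power of V^{(x)n} to V^{(x)(m n)}, as
    a multilinear map. *)
Fixpoint tflat n m : {ffun 'I_m -> tens V n} -> tens V (m * n) :=
  match m with
  | 0 => fun=> tpure [ffun=> 0]
  | p.+1 => fun y => tcat (y ord0) (tflat [ffun j => y (rshift 1 j)])
  end.

Lemma tflat_multilinear n m : multilinear (@tflat n m).
Proof.
elim: m => [|m IHm]; first by move=> x [].
change (multilinear (fun x : {ffun 'I_(1 + m) -> tens V n} =>
  tcat (x ord0) (tflat [ffun j => x (rshift 1 j)]))) => x i a u v.
rewrite !ffunE; case: (split_ordP i) => [i0|j] ->.
  have E w : [ffun j => slot x (lshift m i0) w (rshift 1 j)]
      = [ffun j => x (rshift 1 j)].
    by apply/ffunP=> j; rewrite !ffunE eq_rlshift.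
  by rewrite !E ord1 /= tcat_linearl.
have E w : [ffun i => slot x (rshift 1 j) w (rshift 1 i)]
    = slot [ffun i => x (rshift 1 i)] j w.
  by apply/ffunP=> l; rewrite !ffunE eq_rshift.
by rewrite !E IHm /= tcat_linearr.
Qed.

(** The flattening of a matrix of vectors, specified by its entries rather than
    by a formula with quotients and remainders. *)
Lemma tflat_tpure n m (u : 'I_m -> {ffun 'I_n -> V}) :
  exists2 z, tflat [ffun p => tpure (u p)] = tpure z &
    forall (p : 'I_m) (q : 'I_n) (l : 'I_(m * n)),
      l = (p * n + q)%N :> nat -> z l = u p q.
Proof.
elim: m u => [|m IHm] u /=; first by eexists; [reflexivity | case].
have [z zE zP] := IHm (fun p => u (rshift 1 p)).
exists (fcat (u ord0) z).
  rewrite -tcat_tpure -zE !ffunE; congr (tcat _ (tflat _)).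
  by apply/ffunP => j; rewrite !ffunE.
move=> p q l lE; case: (split_ordP (p : 'I_(1 + m))) => [p0|p'] pE;
  rewrite {}pE in lE *.
  rewrite ord1 in lE *; rewrite (fcatl_val (u ord0) z (j := q)) //.
  by congr (u _ _); apply: val_inj.
have lt_l : (p' * n + q < m * n)%N.
  apply: (@leq_trans (p'.+1 * n)%N); first by rewrite mulSn addnC ltn_add2r.
  by rewrite leq_mul2r ltn_ord orbT.
rewrite (fcatr_val (u ord0) z (j := Ordinal lt_l)); first exact: zP.
by rewrite [LHS]lE /= mulSn addnA.
Qed.

End Tensors.

(** * The factorwise product on tensor powers of an algebra *)

Section TensorMul.
Variables (k : fieldType) (A : algType k) (n : nat).

Definition tmul (s t : tens A n) : tens A n :=
  tlift (fun x => tlift (fun y => tpure [ffun i => x i * y i]) t) s.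

Definition tone : tens A n := tpure [ffun=> 1].

Let pmul_multilinearr (x : {ffun 'I_n -> A}) :
  multilinear (fun y => tpure [ffun i => x i * y i]).
Proof.
move=> y i a u v; have E w : [ffun j => x j * slot y i w j]
    = slot [ffun j => x j * y j] i (x i * w).
  by apply/ffunP => j; rewrite !ffunE; case: eqP => // ->.
by rewrite !E mulrDr -scalerAr tpure_multilinear.
Qed.

Let pmul_multilinearl (y : {ffun 'I_n -> A}) :
  multilinear (fun x => tpure [ffun i => x i * y i]).
Proof.
move=> x i a u v; have E w : [ffun j => slot x i w j * y j]
    = slot [ffun j => x j * y j] i (w * y i).
  by apply/ffunP => j; rewrite !ffunE; case: eqP => // ->.
by rewrite !E mulrDl -scalerAl tpure_multilinear.
Qed.

Lemma tmul_tpure x y : tmul (tpure x) (tpure y) = tpure [ffun i => x i * y i].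
Proof. by rewrite /tmul tlift_tpure ?tlift_tpure //; apply: tlift_multilinear. Qed.

Lemma tmul_linearl t : linear (tmul^~ t).
Proof. by apply: tlift_linear; apply: tlift_multilinear. Qed.

Lemma tmul_linearr s : linear (tmul s).
Proof.
move=> a u v.
apply: (tens_linear_ext (f := fun s => tmul s (a *: u + v))
  (g := fun s => a *: tmul s u + tmul s v)) s => [||x].
- exact: tmul_linearl.
- by move=> c s t; rewrite !tmul_linearl !scalerDr !scalerA mulrC addrACA.
by rewrite /tmul !tlift_tpure; [apply: tlift_linear|apply: tlift_multilinear..].
Qed.

(** The order of the factors is that of r, so r stands for any permutation of
    the indices; each index must occur exactly once for linearity in it. *)
Lemma big_tmul_multilinear m (r : seq 'I_m) :
    uniq r -> (forall i, i \in r) ->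
  multilinear (fun y : {ffun 'I_m -> tens A n} => \big[tmul/tone]_(j <- r) y j).
Proof.
move=> r_uniq r_full y i a u v; move: r_uniq (r_full i); clear r_full.
elim: r => [//|j r IHr] /= /andP [jr r_uniq]; rewrite inE !big_cons !ffunE.
have [-> _|ne_ij] := eqVneq i j.
  have E w : \big[tmul/tone]_(l <- r) slot y j w l
      = \big[tmul/tone]_(l <- r) y l.
    apply: eq_big_seq => l lr; rewrite ffunE; case: eqP => // lj.
    by rewrite -lj lr in jr.
  by rewrite !E tmul_linearl.
by move=> ir; rewrite IHr // tmul_linearr.
Qed.

Lemma big_tmul_tpure m (r : seq 'I_m) (u : 'I_m -> {ffun 'I_n -> A}) :
  \big[tmul/tone]_(j <- r) tpure (u j) = tpure [ffun i => \prod_(j <- r) u j i].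
Proof.
elim: r => [|j r IHr].
  by rewrite big_nil; congr tpure; apply/ffunP => i; rewrite !ffunE big_nil.
rewrite big_cons IHr tmul_tpure; congr tpure; apply/ffunP => i.
by rewrite !ffunE big_cons.
Qed.

End TensorMul.

Lemma tmul_tcat (k : fieldType) (A : algType k) a b (s s' : tens A a)
    (t t' : tens A b) :
  tmul (tcat s t) (tcat s' t') = tcat (tmul s s') (tmul t t').
Proof.
move: s; apply: tens_linear_ext => [c u v|c u v|x].
- by rewrite tcat_linearl tmul_linearl.
- by rewrite tmul_linearl tcat_linearl.
move: s'; apply: tens_linear_ext => [c u v|c u v|x'].
- by rewrite tcat_linearl tmul_linearr.
- by rewrite tmul_linearr tcat_linearl.
move: t; apply: tens_linear_ext => [c u v|c u v|y].
- by rewrite tcat_linearr tmul_linearl.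
- by rewrite tmul_linearl tcat_linearr.
move: t'; apply: tens_linear_ext => [c u v|c u v|y'].
- by rewrite tcat_linearr tmul_linearr.
- by rewrite tmul_linearr tcat_linearr.
rewrite !tcat_tpure !tmul_tpure tcat_tpure; congr tpure; apply/ffunP => i.
by case: (split_ordP i) => j ->; rewrite ffunE ?fcatl ?fcatr ffunE.
Qed.

(** * Iterated coproducts in a bialgebra *)

Section Bialgebra.
Variables (k : fieldType) (H : bialgType k).

Lemma comul_head_linear n : linear (@comul_head k H n).
Proof. exact/tlift_linear/comul_head_multilinear. Qed.

Lemma comul_head_tpure n (x : {ffun 'I_(1 + n) -> H}) :
  comul_head (tpure x) = tcat (comul (x ord0)) (tpure [ffun j => x (rshift 1 j)]).
Proof. by rewrite /comul_head tlift_tpure //; apply: comul_head_multilinear. Qed.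

Lemma comul_head_tcat p b (s : tens H p.+1) (t : tens H b) :
  comul_head (tcat s t : tens H (p + b).+1) = tcat (comul_head s) t
    :> tens H (p + b).+2.
Proof.
move: s; apply: (@tens_linear_ext _ _ _ (tens H (p + b).+2)) => [c u v|c u v|x].
- by rewrite tcat_linearl comul_head_linear.
- by rewrite comul_head_linear tcat_linearl.
move: t; apply: (@tens_linear_ext _ _ _ (tens H (p + b).+2)) => [c u v|c u v|y].
- by rewrite tcat_linearr comul_head_linear.
- by rewrite tcat_linearr.
rewrite tcat_tpure !comul_head_tpure -tcatA2.
have -> : [ffun j => fcat x y (rshift 1 j : 'I_(p.+1 + b))]
    = fcat [ffun j : 'I_p => x (rshift 1 j)] y.
  apply/ffunP => j; rewrite ffunE; case: (split_ordP j) => j' ->.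
    have -> : rshift 1 (lshift b j') = lshift b (rshift 1 j') by apply: val_inj.
    by rewrite !fcatl ffunE.
  have -> : rshift 1 (rshift p j') = rshift p.+1 j' by apply: val_inj.
  by rewrite !fcatr.
congr (tcat (comul _) _).
by rewrite [LHS](fcatl_val x y (j := ord0)).
Qed.

Lemma comul_headM n (s t : tens H n.+1) :
  comul_head (tmul s t) = tmul (comul_head s) (comul_head t).
Proof.
move: s; apply: tens_linear_ext => [c u v|c u v|x].
- by rewrite tmul_linearl comul_head_linear.
- by rewrite comul_head_linear tmul_linearl.
move: t; apply: tens_linear_ext => [c u v|c u v|y].
- by rewrite tmul_linearr comul_head_linear.
- by rewrite comul_head_linear tmul_linearr.
rewrite tmul_tpure !comul_head_tpure (@tmul_tcat _ _ 2) ffunE comulM tmul_tpure.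
do 2!f_equal.
by apply/ffunP => j; rewrite !ffunE.
Qed.

Lemma comul_iterM n (g h : H) :
  comul_iter n (g * h) = tmul (comul_iter n g) (comul_iter n h).
Proof.
case: n => [|p] /=.
  have E : tpure [ffun=> 0] = tone H 0 by congr tpure; apply/ffunP => -[].
  rewrite E (linZ _ _ (@tmul_linearl _ _ _ _)).
  rewrite (linZ _ _ (@tmul_linearr _ _ _ _)).
  rewrite tmul_tpure counitM scalerA; congr (_ *: tpure _).
  by apply/ffunP => -[].
elim: p => [|p IHp] /=; last by rewrite IHp comul_headM.
by rewrite tmul_tpure; congr tpure; apply/ffunP => i; rewrite !ffunE.
Qed.

Lemma comul_iter1 n : comul_iter n (1 : H) = tone H n.
Proof.
case: n => [|p] /=.
  by rewrite counit1 scale1r; congr tpure; apply/ffunP => -[].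
elim: p => [|p IHp] //=.
rewrite IHp comul_head_tpure ffunE comul1 (@tcat_tpure _ _ 2); congr tpure.
apply/ffunP => i; case: (split_ordP (i : 'I_(2 + p))) => j ->.
  by rewrite [LHS](@fcatl _ _ 2 p) !ffunE.
by rewrite [LHS](@fcatr _ _ 2 p) !ffunE.
Qed.

(** Delta^n is a morphism of algebras from H to H^{(x)n}. *)
Lemma comul_iter_prod n m (r : seq 'I_m) (x : 'I_m -> H) :
  comul_iter n (\prod_(j <- r) x j)
    = \big[@tmul k H n/tone H n]_(j <- r) comul_iter n (x j).
Proof. exact: (big_morph _ (comul_iterM n) (comul_iter1 n)). Qed.

(** For a = 0 the generalized coassociativity is the left counit axiom, because
    Delta^0 is the counit. *)
Lemma comul_iterD_counit b (h : H) :
  tmap2 (@comul_iter k H 0) (@comul_iter k H b) (comul h) = comul_iter b h.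
Proof.
rewrite -{2}(counit_comull h) (linear_tlift _ (@comul_iter_linear k H b)).
  apply: eq_tlift => x /=.
  rewrite (linZ _ _ (@tcat_linearl _ _ _ _ _)).
  by rewrite tcat0l (linZ _ _ (@comul_iter_linear _ _ _)).
apply: (bilinear_multilinear (f := fun u v => counit u *: v)) => w c u v.
  by rewrite counit_linear scalerDl scalerA.
by rewrite scalerDr !scalerA mulrC.
Qed.

Lemma comul_head_single (u : H) : comul_head (tsingle u) = comul u.
Proof.
rewrite [LHS](comul_head_tpure (n := 0)) ffunE.
move: (comul u); apply: tens_linear_ext => [||x].
- exact: (@tcat_linearl _ _ 2 0).
- by [].
rewrite [LHS](@tcat_tpure _ _ 2 0); congr tpure; apply/ffunP => i.
exact: (@fcatl_val _ _ 2 0).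
Qed.

(** Sweedler's h_1 (x) h_2 (x) D h_3, computed in two ways: the coassociativity
    axiom, followed by D on the third factor. *)
Lemma tmap2_comul_assoc b (D : H -> tens H b) (h : H) :
    linear D ->
  tmap2 comul D (comul h)
    = tmap2 (@tsingle k H) (fun u => tmap2 (@tsingle k H) D (comul u)) (comul h)
    :> tens H b.+2.
Proof.
move=> Dl; have sl := @tsingle_linear k H.
(* F is id (x) id (x) D; Lr and Ll evaluate it on the two sides of comulA. *)
pose F (x : {ffun 'I_(2 + 1) -> H}) : tens H (2 + b) :=
  tcat (tpure [ffun i : 'I_2 => x (lshift 1 i)]) (D (x (rshift 2 ord0))).
have Fl : multilinear F.
  move=> x i c u v; rewrite /F; have [j ->|j ->] := split_ordP i.
    have E w : [ffun i => slot x (lshift 1 j) w (lshift 1 i)]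
        = slot [ffun i => x (lshift 1 i)] j w.
      by apply/ffunP=> l; rewrite !ffunE eq_lshift.
    by rewrite !E !ffunE eq_rlshift tpure_multilinear tcat_linearl.
  have E w : [ffun i => slot x (rshift 2 j) w (lshift 1 i)]
      = [ffun i => x (lshift 1 i)].
    by apply/ffunP=> l; rewrite !ffunE eq_lrshift.
  by rewrite !E ord1 !ffunE eqxx Dl tcat_linearr.
have Lr s v : tlift F (tcat s (tsingle v)) = tcat s (D v).
  move: s; apply: tens_linear_ext => [c s t|c s t|x].
  - by rewrite tcat_linearl (tlift_linear Fl).
  - by rewrite tcat_linearl.
  rewrite tcat_tpure tlift_tpure // /F fcatr ffunE.
  by congr (tcat (tpure _) _); apply/ffunP => i; rewrite ffunE fcatl.
have Ll u s : tlift F (tcat (tsingle u) s)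
    = tcat (tsingle u) (tmap2 (@tsingle k H) D s).
  move: s; apply: (@tens_linear_ext _ _ _ (tens H (2 + b))) => [c s t|c s t|x].
  - by rewrite tcat_linearr (tlift_linear Fl).
  - by rewrite (tmap2_linear sl Dl) (@tcat_linearr _ _ 1 (1 + b)).
  pose z : {ffun 'I_(2 + 1) -> H} := @fcat _ _ 1 2 [ffun=> u] x.
  have z1 : [ffun i => z (lshift 1 i)] = @fcat _ _ 1 1 [ffun=> u] [ffun=> x ord0].
    apply/ffunP => i; rewrite ffunE; case: (split_ordP (i : 'I_(1 + 1))) => j ->.
      by rewrite [RHS]fcatl; apply: (@fcatl_val _ _ 1 2).
    rewrite [RHS]fcatr [RHS]ffunE.
    by apply: (@fcatr_val _ _ 1 2); rewrite /= ord1.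
  have z2 : z (rshift 2 ord0) = x ord_max by apply: (@fcatr_val _ _ 1 2).
  rewrite tmap2_tpure // -tcatA11 !tcat_tpure [LHS](tlift_tpure Fl z).
  by rewrite /F z1 z2.
have Ll3 := tlift_linear Fl; have dl := @comul_linear k H.
transitivity (tlift F (tmap2 comul (@tsingle k H) (comul h))).
  rewrite [RHS](linear_tlift _ Ll3); last exact: (tmap2_multilinear dl sl).
  by apply: eq_tlift => x; rewrite Lr.
rewrite comulA [LHS](linear_tlift _ Ll3); last exact: (tmap2_multilinear sl dl).
by apply: eq_tlift => x; rewrite Ll.
Qed.

(** Delta^(b + 1) is defined by splitting the first factor of Delta^b; it is
    also obtained by keeping the first factor of Delta and expanding the second
    one. *)
Lemma comul_iterD_single b (h : H) :
  tmap2 (@tsingle k H) (@comul_iter k H b) (comul h) = comul_iter b.+1 h.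
Proof.
have sl := @tsingle_linear k H.
(* For b = 0 this is the right counit axiom, and b = 1 is the base case of the
   recursion that defines the iterated coproduct. *)
elim: b h => [|[|p] IHp] h.
- rewrite -[in RHS](counit_comulr h) [RHS](linear_tlift _ sl); last first.
    apply: (bilinear_multilinear (f := fun u v => counit v *: u)) => w c u v.
      by rewrite scalerDr !scalerA mulrC.
    by rewrite counit_linear scalerDl scalerA.
  apply: eq_tlift => x /=.
  rewrite (linZ _ _ (@tcat_linearr _ _ 1 0 _)) (linZ _ _ sl); congr (_ *: _).
  rewrite [LHS](@tcat_tpure _ _ 1 0); congr tpure; apply/ffunP => i.
  exact: (@fcatl_val _ _ 1 0).
- by rewrite [LHS]tmap2_single -comul_head_single.
transitivity (tmap2 comul (comul_iter p.+1) (comul h)).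
  rewrite tmap2_comul_assoc; last exact: comul_iter_linear.
  by congr (tmap2 _ _ _); apply: funext => u; rewrite IHp.
rewrite -[RHS]/(comul_head (comul_iter p.+2 h)) -IHp.
rewrite [RHS](linear_tlift _ (comul_head_linear (n := p.+1))).
  by apply: eq_tlift => x; rewrite (comul_head_tcat (p := 0)) comul_head_single.
exact: (tmap2_multilinear sl (comul_iter_linear p.+1)).
Qed.

(** Splitting the first factor of Delta^(a + b) only affects its Delta^a part,
    as long as a is positive. *)
Lemma comul_iterD a b (h : H) :
  tmap2 (@comul_iter k H a) (@comul_iter k H b) (comul h) = comul_iter (a + b) h.
Proof.
case: a => [|p]; first exact: comul_iterD_counit.
elim: p => [|p IHp]; first exact: comul_iterD_single.
rewrite -[RHS]/(comul_head (comul_iter (p.+1 + b) h)) -IHp.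
rewrite [RHS](linear_tlift _ (comul_head_linear (n := p + b))).
  by apply: eq_tlift => x; rewrite comul_head_tcat.
exact: (tmap2_multilinear (comul_iter_linear p.+1) (comul_iter_linear b)).
Qed.

Lemma comul_tflat_multilinear n m :
  multilinear (fun x : {ffun 'I_m -> H} => tflat [ffun p => comul_iter n (x p)]).
Proof.
move=> x i c u v; have E w : [ffun q => comul_iter n (slot x i w q)]
    = slot [ffun q => comul_iter n (x q)] i (comul_iter n w).
  by apply/ffunP => q; rewrite !ffunE; case: eqP.
by rewrite !E comul_iter_linear tflat_multilinear.
Qed.

(** Induction on m: both sides split as a first factor and the rest, by
    comul_iterD with the blocks n and m n on the left, 1 and m on the right. *)
Lemma comul_iter_flat n m (h : H) :
  comul_iter (m * n) h
    = tlift (fun x : {ffun 'I_m -> H} => tflat [ffun p => comul_iter n (x p)])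
        (comul_iter m h).
Proof.
have Fl := comul_tflat_multilinear n.
elim: m h => [|m IHm] h.
  rewrite /= (linZ (f := tlift _)); last exact: tlift_linear.
  by rewrite tlift_tpure.
rewrite -[LHS](comul_iterD n (m * n)) -[comul_iter m.+1 h](comul_iterD 1 m).
rewrite [RHS](linear_tlift _ (tlift_linear (Fl m.+1))); last first.
  exact: (tmap2_multilinear (comul_iter_linear 1) (comul_iter_linear m)).
apply: eq_tlift => x; rewrite IHm.
move: (x ord0) (x ord_max) => u v.
move: (comul_iter m v); apply: tens_linear_ext => [c s t|c s t|y].
- by rewrite (tlift_linear (Fl m)) tcat_linearr.
- by rewrite (@tcat_linearr _ _ 1) (tlift_linear (Fl m.+1)).
rewrite (@tcat_tpure _ _ 1) !tlift_tpure //= ffunE.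
congr (tcat (comul_iter n _) (tflat _)).
  by rewrite [RHS](@fcatl_val _ _ 1 m _ _ _ ord0) // ffunE.
apply/ffunP => j; rewrite ffunE [RHS]ffunE [RHS]ffunE; congr (comul_iter n _).
exact/esym/(@fcatr_val _ _ 1 m).
Qed.

(** * The operations Psi as ordered products *)

Lemma mul_iter_tpure n (x : {ffun 'I_n -> H}) : mul_iter (tpure x) = \prod_i x i.
Proof.
case: n x => [|p] x.
  by rewrite /= tlift_tpure ?big_ord0 // => ? [].
rewrite /mul_iter; elim: p x => [|p IHp] x /=.
  rewrite tlift_tpure ?big_ord1 // => y i a u v.
  by rewrite !ffunE [i]ord1.
rewrite /mul_head tlift_tpure; last exact: mul_head_multilinear.
rewrite (@tcat_tpure _ _ 1) IHp big_ord_recl [RHS]big_ord_recl.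
rewrite [X in _ = _ * X]big_ord_recl mulrA.
congr (_ * _).
  rewrite [LHS](@fcatl_val _ _ 1 p _ _ _ ord0) // ffunE.
  by congr (x _ * x _); apply: val_inj.
apply: eq_bigr => i _; rewrite [LHS](@fcatr_val _ _ 1 p _ _ _ i) // ffunE.
by congr (x _); apply: val_inj.
Qed.

Lemma prod_perm_multilinear n (s : 'S_n) :
  multilinear (fun x : {ffun 'I_n -> H} => \prod_i x ((s^-1)%g i)).
Proof.
have := linear_multilinear (@mul_iter_linear k H n) (tens_perm_multilinear s).
apply: eq_multilinear => x.
by rewrite mul_iter_tpure; apply: eq_bigr => i _; rewrite ffunE.
Qed.

Lemma PsiE n (s : 'S_n) (h : H) :
  Psi s h = tlift (fun x => \prod_i x ((s^-1)%g i)) (comul_iter n h).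
Proof.
rewrite /Psi /tens_perm linear_tlift; last 2 first.
- exact: mul_iter_linear.
- exact: tens_perm_multilinear.
apply: eq_tlift => x; rewrite mul_iter_tpure.
by apply: eq_bigr => i _; rewrite ffunE.
Qed.

(** Needed because flattening produces tensors of length m n, while Phi permutes
    n m letters. *)
Lemma tlift_comul_iter_cast N N' (e : N = N') (W : lmodType k)
    (f : {ffun 'I_N -> H} -> W) (h : H) :
  tlift f (comul_iter N h)
    = tlift (fun x : {ffun 'I_N' -> H} => f [ffun i => x (cast_ord e i)])
        (comul_iter N' h).
Proof.
case: N' / e; apply: eq_tlift => x; congr f; apply/ffunP => i.
by rewrite ffunE cast_ord_id.
Qed.

End Bialgebra.

(** * Comparison of the two orders of the factors *)

(** The map l = i m + j enumerates the pairs (i, j) in lexicographic order, so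
    the terms of the two sides come in the same order. *)
Lemma big_ord_mul (R : Type) (idx : R) (op : Monoid.law idx) n m
    (F : 'I_(n * m) -> R) (G : 'I_n -> 'I_m -> R) :
    (forall (i : 'I_n) (j : 'I_m) (l : 'I_(n * m)),
       l = (i * m + j)%N :> nat -> F l = G i j) ->
  \big[op/idx]_l F l = \big[op/idx]_i \big[op/idx]_j G i j.
Proof.
elim: n F G => [|n IHn] F G FG; first by rewrite !big_ord0.
rewrite big_ord_recl (@big_split_ord _ _ _ m (n * m)); congr (op _ _).
  by apply: eq_bigr => j _; apply: FG.
by apply: IHn => i j l lE; apply: FG; rewrite /= lE addnA.
Qed.

Lemma Phi_inv_val n m (s : 'S_n) (t : 'S_m) (i : 'I_n) (j : 'I_m) (l : 'I_(n * m)) :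
    l = (i * m + j)%N :> nat ->
  ((Phi s t)^-1)%g l = (((t^-1)%g j) * n + (s^-1)%g i)%N :> nat.
Proof.
move=> lE; set p := (t^-1)%g j; set q := (s^-1)%g i.
have n_gt0 : (0 < n)%N by apply: leq_ltn_trans (ltn_ord q).
have lt_l' : (p * n + q < n * m)%N.
  apply: (@leq_trans (p.+1 * n)%N); first by rewrite mulSn addnC ltn_add2r.
  by rewrite mulnC leq_mul2l ltn_ord orbT.
have -> : l = Phi s t (Ordinal lt_l'); last by rewrite permK.
apply: val_inj; rewrite permE /= lE.
have -> : Phi_quo (Ordinal lt_l') = p.
  by apply: val_inj; rewrite /= divnMDl // divn_small ?addn0.
have -> : Phi_rem (Ordinal lt_l') = q.
  by apply: val_inj; rewrite /= modnMDl modn_small.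
by rewrite !permKV addnC mulnC.
Qed.

Theorem mainTheorem2 (k : fieldType) (H : bialgType k) (n m : nat)
    (s : 'S_n) (t : 'S_m) :
  (Psi s : H -> H) \o (Psi t : H -> H) =1 Psi (Phi s t).
Proof.
move=> h /=; rewrite [Psi t h]PsiE PsiE [RHS]PsiE.
have st := prod_perm_multilinear; have dl := @comul_iter_linear k H.
rewrite (linear_tlift (comul_iter m h) (dl n) (st k H m t)).
rewrite [LHS](linear_tlift _ (tlift_linear (st k H n s))); last first.
  exact: linear_multilinear (dl n) (st k H m t).
(* The right-hand side, as a function of the tensors Delta^n h_p. *)
pose e := mulnC n m.
rewrite (tlift_comul_iter_cast e) comul_iter_flat.
have rl : multilinear (fun z : {ffun 'I_(m * n) -> H} =>
    \prod_i [ffun i => z (cast_ord e i)] (((Phi s t)^-1)%g i)).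
  exact: (multilinear_reindex (cast_ordK e) (cast_ordKV e) (st _ _ _ _)).
rewrite [RHS](linear_tlift _ (tlift_linear rl)); last exact: comul_tflat_multilinear.
(* The order of the factors in Psi t is moved from the summand to the list of
   indices, so that the left-hand side too is a function of these tensors. *)
apply: eq_tlift => x; rewrite -(big_map _ xpredT x) comul_iter_prod.
rewrite (eq_bigr [ffun p => comul_iter n (x p)]); last by move=> j _; rewrite ffunE.
move: [ffun p => _]; apply: multilinear_tpure_ext.
- apply: (linear_multilinear (tlift_linear (st k H n s))).
  apply: big_tmul_multilinear => [|i].
    by rewrite map_inj_uniq ?index_enum_uniq //; apply: perm_inj.
  by rewrite -(permK t i) map_f // mem_index_enum.
- exact: (linear_multilinear (tlift_linear rl) (@tflat_multilinear _ _ n m)).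
move=> u; have [z -> zP] := tflat_tpure u.
rewrite (eq_bigr (fun p => tpure (u p))); last by move=> j _; rewrite ffunE.
rewrite big_tmul_tpure (tlift_tpure (st k H n s)) (tlift_tpure rl); symmetry.
transitivity (\prod_(i < n) \prod_(j < m) u ((t^-1)%g j) ((s^-1)%g i)).
  apply: big_ord_mul => i j l lE; rewrite ffunE; apply: zP.
  exact: Phi_inv_val.
by apply: eq_bigr => i _; rewrite ffunE big_map.
Qed.
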